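(* Let $f,g\in\mathbb{C}[x_1,\ldots,x_n]$ be two non-constant polynomials and let $m\ge 0$ be an integer. Assume that the Bernstein-Sato ideal $B_{f,g}$ satisfies the $\mathcal{C}_m$-condition, i.e. there exists $b(s_1,s_2)\in B_{f,g}$ such that for every integer $i\ge 1$ the polynomial $b(s-i,\,-s-m-i)\in\mathbb{C}[s]$ is not the zero polynomial. Then $$I_m(s)=\mathrm{Sat}_{\mathbb{C}[s]}\bigl(I(s,-s-m)\bigr).$$
   Context: $D=\mathbb{C}[x_1,\ldots,x_n]\langle\partial_1,\ldots,\partial_n\rangle$ is the $n$th Weyl algebra over $\mathbb{C}$ (with $\partial_i x_i=x_i\partial_i+1$), $D[s]=D\otimes_{\mathbb{C}}\mathbb{C}[s]$ and $D[s_1,s_2]=D\otimes_{\mathbb{C}}\mathbb{C}[s_1,s_2]$, where $s,s_1,s_2$ are commuting central variables. The free rank-one module $\mathbb{C}[x,s,\frac1{fg}]\left(\frac fg\right)^s$ is a left $D[s]$-module: polynomials in $x,s$ act by multiplication and $\partial_i\bullet u\left(\frac fg\right)^s=\left(\frac{\partial u}{\partial x_i}+s\,u\,\frac{\partial f/\partial x_i}{f}-s\,u\,\frac{\partial g/\partial x_i}{g}\right)\left(\frac fg\right)^s$ for $u\in\mathbb{C}[x,s,\frac1{fg}]$. Similarly the free rank-one module $\mathbb{C}[x,s_1,s_2,\frac1{fg}]f^{s_1}g^{s_2}$ is a left $D[s_1,s_2]$-module with $\partial_i\bullet u f^{s_1}g^{s_2}=\left(\frac{\partial u}{\partial x_i}+s_1u\frac{\partial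 f/\partial x_i}{f}+s_2u\frac{\partial g/\partial x_i}{g}\right)f^{s_1}g^{s_2}$. Here $f^{s_1+1}g^{s_2+1}$ means $fg\cdot f^{s_1}g^{s_2}$. $I_m(s)=\mathrm{Ann}_{D[s]}\frac1{g^m}\left(\frac fg\right)^s\subset D[s]$ is the left ideal of operators annihilating $\frac1{g^m}\left(\frac fg\right)^s$. $I(s_1,s_2)=\mathrm{Ann}_{D[s_1,s_2]}f^{s_1}g^{s_2}\subset D[s_1,s_2]$, and $I(s,-s-m)\subset D[s]$ is the left ideal obtained from $I(s_1,s_2)$ by the substitution $s_1=s$, $s_2=-s-m$. The Bernstein-Sato ideal $B_{f,g}\subset\mathbb{C}[s_1,s_2]$ is the ideal of all $b(s_1,s_2)\in\mathbb{C}[s_1,s_2]$ for which there is $P(s_1,s_2)\in D[s_1,s_2]$ with $b(s_1,s_2)f^{s_1}g^{s_2}=P(s_1,s_2)f^{s_1+1}g^{s_2+1}$. For a left ideal $I\subset D[s]$, its $\mathbb{C}[s]$-saturation is the left ideal $\mathrm{Sat}_{\mathbb{C}[s]}(I)=\{P(s)\in D[s]\mid \exists\, q(s)\in\mathbb{C}[s]\setminus\{0\},\ q(s)P(s)\in I\}$. *)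

(* Defs.v *)
From HB Require Import structures.
From mathcomp Require Import all_boot all_order all_algebra ring.
From mathcomp Require Import boolp classical_sets reals.
From mathcomp Require Import complex ssrcomplements mpoly.

Set Implicit Arguments.
Unset Strict Implicit.
Unset Printing Implicit Defensive.

Import Order.TTheory GRing.Theory Num.Theory.
Local Open Scope ring_scope.

(* An operator in normal form [\sum_a P_a d^a] has its coefficients on the
   left: [P : {mpoly {mpoly K[n]}[n]}], where the inner variables are the x_i
   and the outer ones stand for the d_i.  If the d_i act on a [K[x]]-module [M]
   through commuting maps [nabla i] which satisfy the Leibniz rule, then [P]
   acts through [opact nabla P]. *)
Section OperatorAction.
Variables (n : nat) (K : comNzRingType) (M : lmodType {mpoly K[n]}).
Variable nabla : 'I_n -> M -> M.

Definition dpow (a : 'X_{1..n}) (u : M) : M :=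
  foldr (fun i => iter (a i) (nabla i)) u (enum 'I_n).

Definition opact (P : {mpoly {mpoly K[n]}[n]}) (u : M) : M :=
  \sum_(a <- msupp P) P@_a *: dpow a u.

Hypothesis nablaD : forall i, {morph nabla i : u v / u + v}.
Hypothesis nablaZ : forall i (a : {mpoly K[n]}) u,
  nabla i (a *: u) = a^`M(i) *: u + a *: nabla i u.
Hypothesis nablaC : forall i j u, nabla i (nabla j u) = nabla j (nabla i u).

Lemma nabla0 i : nabla i 0 = 0.
Proof. by apply: (addIr (nabla i 0)); rewrite -nablaD !add0r. Qed.

Lemma nabla_sum i (I : Type) (r : seq I) (F : I -> M) :
  nabla i (\sum_(j <- r) F j) = \sum_(j <- r) nabla i (F j).
Proof. exact: (big_morph _ (nablaD i) (nabla0 i)). Qed.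

Lemma dpowD a : {morph dpow a : u v / u + v}.
Proof.
move=> u v; rewrite /dpow; elim: (enum _) => //= i s ->.
by elim: (a i) => //= k ->; rewrite nablaD.
Qed.

Lemma dpow_nabla a i u : dpow (a + U_(i))%MM u = nabla i (dpow a u).
Proof.
have iterC j k v : iter k (nabla j) (nabla i v) = nabla i (iter k (nabla j) v).
  by elim: k => //= k ->.
rewrite /dpow; have := mem_enum 'I_n i; have := enum_uniq 'I_n.
suff H s : uniq s ->
    foldr (fun j => iter ((a + U_(i))%MM j) (nabla j)) u s =
    (if i \in s then nabla i else id)
      (foldr (fun j => iter (a j) (nabla j)) u s).
  by move=> /H -> ->.
elim: s => //= j s IH /andP[js us]; rewrite IH // mnmDE mnm1E in_cons.
have [->|ne] /= := eqVneq i j; first by rewrite (negPf js) addn1.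
by rewrite addn0; case: ifP => // _; rewrite iterC.
Qed.

Lemma dpow0 u : dpow 0%MM u = u.
Proof.
rewrite /dpow; elim: (enum _) => //= i s ->; by rewrite mnm0E.
Qed.

Lemma opactwE P u k : (msize P <= k)%N ->
  opact P u = \sum_(a : 'X_{1..n < k}) P@_a *: dpow a u.
Proof.
move=> le; rewrite /opact (big_mksub 'X_{1..n < k}) /=; first last.
  by move=> x /msize_mdeg_lt/leq_trans/(_ le).
  by rewrite msupp_uniq.
rewrite big_rmcond //= => j /memN_msupp_eq0 ->; by rewrite scale0r.
Qed.

Lemma opactDr P : {morph opact P : u v / u + v}.
Proof.
move=> u v; rewrite /opact -big_split; apply: eq_bigr => a _.
by rewrite dpowD scalerDr.
Qed.

Lemma opactDl P Q u : opact (P + Q) u = opact P u + opact Q u.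
Proof.
pose k := maxn (msize (P + Q)) (maxn (msize P) (msize Q)).
rewrite !(@opactwE _ _ k) ?leq_max ?leqnn ?orbT // -big_split.
by apply: eq_bigr => a _; rewrite mcoeffD scalerDl.
Qed.

Lemma opactZl a P u : opact (a *: P) u = a *: opact P u.
Proof.
pose k := maxn (msize (a *: P)) (msize P).
rewrite !(@opactwE _ _ k) ?leq_max ?leqnn ?orbT // scaler_sumr.
by apply: eq_bigr => b _; rewrite mcoeffZ scalerA.
Qed.

Lemma opact0l u : opact 0 u = 0.
Proof. by rewrite /opact msupp0 big_nil. Qed.

Lemma opact_suml (I : Type) (r : seq I) (F : I -> _) u :
  opact (\sum_(j <- r) F j) u = \sum_(j <- r) opact (F j) u.
Proof. exact: (big_morph (opact^~ u) (fun P Q => opactDl P Q u) (opact0l u)). Qed.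

Lemma opactX a u : opact 'X_[a] u = dpow a u.
Proof. by rewrite /opact msuppX big_seq1 mcoeffX eqxx scale1r. Qed.

Lemma opact1l u : opact 1 u = u.
Proof. by rewrite -mpolyX0 opactX dpow0. Qed.

End OperatorAction.

Lemma map_mpoly_comm (n : nat) (A : nzRingType) (d e : {additive A -> A}) :
  (forall x, d (e x) = e (d x)) ->
  forall p : {mpoly A[n]},
    map_mpoly d (map_mpoly e p) = map_mpoly e (map_mpoly d p).
Proof.
move=> de p; apply/mpolyP=> m.
by rewrite !(mcoeff_map_mpoly d) !(mcoeff_map_mpoly e) mcoeff_map_mpoly de.
Qed.

(* Left multiplication by d_i on normal forms, forced by the relation
   [d_i a = a d_i + a^`M(i)]. *)
Definition dmul (n : nat) (K : comNzRingType) (i : 'I_n)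
    (Q : {mpoly {mpoly K[n]}[n]}) : {mpoly {mpoly K[n]}[n]} :=
  'X_i * Q + map_mpoly (mderiv i) Q.

Section Dmul.
Variables (n : nat) (K : comNzRingType).
Local Notation W := {mpoly {mpoly K[n]}[n]}.
Implicit Types P Q : W.

Lemma dmulD i : {morph (@dmul n K i) : u v / u + v}.
Proof. by move=> u v; rewrite /dmul raddfD mulrDr addrACA. Qed.

Lemma dmulZ i (a : {mpoly K[n]}) (u : W) :
  dmul i (a *: u) = a^`M(i) *: u + a *: dmul i u.
Proof.
rewrite /dmul scalerDr -scalerAr addrCA; congr (_ + _).
apply/mpolyP=> m; rewrite mcoeff_map_mpoly !(mcoeffD, mcoeffZ).
by rewrite mcoeff_map_mpoly /= mderivM.
Qed.

Lemma map_mderivX i j (u : W) :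
  map_mpoly (mderiv j) ('X_i * u) = 'X_i * map_mpoly (mderiv j) u.
Proof.
elim/mpolyind: u => [|c m p _ _ IH]; first by rewrite mulr0 raddf0 mulr0.
rewrite mulrDr !raddfD /= IH mulrDr; congr (_ + _).
rewrite -scalerAr -mpolyXD.
have E (b : 'X_{1..n}) :
    map_mpoly (mderiv j) (c *: 'X_[b]) = c^`M(j) *: 'X_[b].
  apply/mpolyP=> l; rewrite mcoeff_map_mpoly !mcoeffZ mcoeffX.
  by case: eqP; rewrite ?mulr1 // !mulr0 raddf0.
by rewrite !E -scalerAr -mpolyXD.
Qed.

Lemma dmulC i j (u : W) : dmul i (dmul j u) = dmul j (dmul i u).
Proof.
have E : map_mpoly (mderiv i) (map_mpoly (mderiv j) u) =
         map_mpoly (mderiv j) (map_mpoly (mderiv i) u).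
  exact: (map_mpoly_comm (@mderiv_comm n K j i)).
rewrite /dmul !raddfD /= !map_mderivX !mulrDr !mulrA ['X_i * 'X_j]mulrC E.
move: ('X_j * _ * u) ('X_i * _) ('X_j * _) (map_mpoly _ (map_mpoly _ u)).
by move=> a b c d; rewrite addrACA.
Qed.

Lemma dpow_dmul1 (a : 'X_{1..n}) : dpow (@dmul n K) a 1 = 'X_[a].
Proof.
have dX i (b : 'X_{1..n}) :
    @dmul n K i 'X_[b] = 'X_[U_(i) + b].
  rewrite /dmul -mpolyXD; rewrite (_ : map_mpoly _ _ = 0) ?addr0 //.
  apply/mpolyP=> m; rewrite mcoeff_map_mpoly mcoeffX mcoeff0.
  by case: eqP; rewrite ?raddf0 //= -mpolyC1 mderivC.
suff H s : foldr (fun i => iter (a i) (@dmul n K i)) 1 s =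
    'X_[\sum_(i <- s) U_(i) *+ a i].
  by rewrite /dpow H [in RHS](multinomUE_id a) /index_enum -enumT.
elim: s => [|i s /= ->]; first by rewrite big_nil mpolyX0.
rewrite big_cons; elim: (a i) => [|k /= ->]; first by rewrite mulm0n add0m.
by rewrite dX mulmS addmA.
Qed.

Lemma opact_dmul1 (Q : W) : opact (@dmul n K) Q 1 = Q.
Proof.
by rewrite [RHS]mpolyE; apply: eq_bigr => a _; rewrite dpow_dmul1.
Qed.

Section OpactMul.
Variable (M : lmodType {mpoly K[n]}) (nabla : 'I_n -> M -> M).
Hypothesis nablaD : forall i, {morph nabla i : u v / u + v}.
Hypothesis nablaZ : forall i (a : {mpoly K[n]}) u,
  nabla i (a *: u) = a^`M(i) *: u + a *: nabla i u.
Hypothesis nablaC : forall i j u, nabla i (nabla j u) = nabla j (nabla i u).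

Lemma opact_dmul i (Q : W) u :
  opact nabla (dmul i Q) u = nabla i (opact nabla Q u).
Proof.
rewrite [Q in LHS]mpolyE.
have dmul0 : @dmul n K i 0 = 0 by rewrite /dmul mulr0 raddf0 addr0.
rewrite (big_morph _ (dmulD i) dmul0) opact_suml [opact _ Q _]/opact nabla_sum //.
apply: eq_bigr => a _; rewrite dmulZ nablaZ opactDl !opactZl opactX.
congr (_ + _ *: _); rewrite /dmul (_ : map_mpoly _ _ = 0) ?addr0.
  by rewrite -mpolyXD opactX addmC dpow_nabla.
apply/mpolyP=> m; rewrite mcoeff_map_mpoly mcoeffX mcoeff0.
by case: eqP; rewrite ?raddf0 //= -mpolyC1 mderivC.
Qed.

Lemma opactM (P Q : W) u :
  opact nabla (opact (@dmul n K) P Q) u = opact nabla P (opact nabla Q u).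
Proof.
rewrite [X in opact nabla X]/opact opact_suml; apply: eq_bigr => a _.
rewrite opactZl; congr (_ *: _); rewrite /dpow.
elim: (enum _) => //= i s <-; elim: (a i) => //= k <-.
exact: opact_dmul.
Qed.

End OpactMul.
End Dmul.

(* The Weyl algebra over [K]: operators in normal form.  [weyl n R[i]] is D,
   and D (x) C[s], D (x) C[s1,s2] are the Weyl algebras over C[s], C[s1,s2]. *)
Definition weyl (n : nat) (K : comNzRingType) : Type :=
  {mpoly {mpoly K[n]}[n]}.

Section WeylRing.
Variables (n : nat) (K : comNzRingType).
Local Notation W := {mpoly {mpoly K[n]}[n]}.

HB.instance Definition _ := GRing.Zmodule.copy (weyl n K) W.

Definition weyl_mul (P Q : weyl n K) : weyl n K := opact (@dmul n K) P Q.
Definition weyl_one : weyl n K := (1 : W).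

Fact weyl_mulA : associative weyl_mul.
Proof.
move=> P Q S.
apply: esym; exact: (opactM (@dmulD n K) (@dmulZ n K) (@dmulC n K)).
Qed.

Fact weyl_mul1l : left_id weyl_one weyl_mul.
Proof. by move=> P; apply: opact1l. Qed.

Fact weyl_mul1r : right_id weyl_one weyl_mul.
Proof. by move=> P; apply: opact_dmul1. Qed.

Fact weyl_mulDl : left_distributive weyl_mul +%R.
Proof. by move=> P Q S; apply: opactDl. Qed.

Fact weyl_mulDr : right_distributive weyl_mul +%R.
Proof. by move=> P Q S; apply: opactDr; apply: dmulD. Qed.

Fact weyl_one_neq0 : weyl_one != 0.
Proof. exact: (@oner_neq0 W). Qed.

HB.instance Definition _ := GRing.Zmodule_isNzRing.Build (weyl n K)
  weyl_mulA weyl_mul1l weyl_mul1r weyl_mulDl weyl_mulDr weyl_one_neq0.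

Definition weyl_poly (a : {mpoly K[n]}) : weyl n K := a%:MP.
Definition weyl_const (c : K) : weyl n K := weyl_poly c%:MP.
Definition weyl_x (i : 'I_n) : weyl n K := weyl_poly 'X_i.
Definition weyl_d (i : 'I_n) : weyl n K := ('X_i : W).

End WeylRing.

Section WeylAct.
Variables (n : nat) (K : comNzRingType) (M : lmodType {mpoly K[n]}).
Variable nabla : 'I_n -> M -> M.

Lemma opact_poly (a : {mpoly K[n]}) u : opact nabla (weyl_poly a) u = a *: u.
Proof.
by rewrite /weyl_poly -[_%:MP]mulr1 mul_mpolyC opactZl opact1l.
Qed.

Lemma opact_d i u : (forall j k v, nabla j (nabla k v) = nabla k (nabla j v)) ->
  opact nabla (weyl_d K i) u = nabla i u.
Proof.
by move=> nablaC; rewrite /weyl_d opactX -[U_(i)%MM]add0m dpow_nabla // dpow0.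
Qed.
End WeylAct.

Lemma weyl_dx (n : nat) (K : comNzRingType) (i j : 'I_n) :
  weyl_d K i * weyl_x K j = weyl_x K j * weyl_d K i + (i == j)%:R.
Proof.
have -> : weyl_d K i * weyl_x K j = dmul i (weyl_x K j).
  by apply: opact_d; apply: dmulC.
have -> : weyl_x K j * weyl_d K i = 'X_j *: (weyl_d K i : {mpoly {mpoly K[n]}[n]}).
  exact: opact_poly.
rewrite /dmul /weyl_x /weyl_poly map_mpolyC mulrC mul_mpolyC /= mderivX mnm1E.
rewrite [j == i]eq_sym; case: eqP => [->|_]; last by rewrite scale0r mpolyC0.
have -> : (U_(j) - U_(j))%MM = 0%MM by apply/mnmP=> k; rewrite mnmBE subnn mnm0E.
by rewrite mpolyX0 scale1r mpolyC1.
Qed.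

(* The derivation of [{fraction A}] which extends the derivation [d] of [A]. *)
Definition fracD (A : idomainType) (d : A -> A) (u : {fraction A}) :
    {fraction A} :=
  let p := \n_(repr u) in let q := \d_(repr u) in
  tofrac (d p * q - p * d q) / tofrac (q ^+ 2).

Section FracD.
Variables (A : idomainType).
Local Notation "x %:F" := (@FracField.tofrac A x).

Lemma fracP (u : {fraction A}) : u = (\n_(repr u))%:F / (\d_(repr u))%:F.
Proof.
rewrite -{1}[u]reprK; move: (repr u) => r; unlock FracField.tofrac.
rewrite -[X in _ * X]FracField.pi_inv -[RHS]FracField.pi_mul.
rewrite /FracField.mulf /FracField.invf.
rewrite !numden_Ratio ?oner_eq0 ?denom_ratioP //.
by rewrite mulr1 mul1r Ratio_numden.
Qed.

Section One.
Variable d : A -> A.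
Hypothesis dD : {morph d : x y / x + y}.
Hypothesis dM : forall x y, d (x * y) = d x * y + x * d y.

Lemma fracDE p q : q != 0 ->
  fracD d (p%:F / q%:F) = (d p * q - p * d q)%:F / (q ^+ 2)%:F.
Proof.
move=> q0; set u := _ / _.
have [a [b [b0 Hu ->]]] : exists a b, [/\ b != 0, u = a%:F / b%:F
    & fracD d u = (d a * b - a * d b)%:F / (b ^+ 2)%:F].
  exists \n_(repr u), \d_(repr u); split => //; first exact: denom_ratioP.
  exact: fracP.
have E : a * q = p * b.
  apply/eqP; rewrite -tofrac_eq !tofracM; apply/eqP.
  have {}b0 : b%:F != 0 by rewrite tofrac_eq0.
  have {}q0 : q%:F != 0 by rewrite tofrac_eq0.
  by move: Hu; rewrite /u => /eqP; rewrite eqr_div // => /eqP ->.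
have dE : d a * q + a * d q = d p * b + p * d b by rewrite -!dM E.
apply/eqP; rewrite eqr_div ?tofrac_eq0 ?expf_neq0 // -!tofracM tofrac_eq.
apply/eqP.
have -> : (d a * b - a * d b) * q ^+ 2 =
   b * q * (d a * q + a * d q) - (a * q) * (b * d q + d b * q) by ring.
rewrite dE E; ring.
Qed.

Lemma fracD_tofrac p : fracD d p%:F = (d p)%:F.
Proof.
have d1 : d 1 = 0.
  by apply: (addIr (d 1)); rewrite add0r -{3}[1]mulr1 dM mulr1 mul1r.
rewrite -[p%:F]divr1 -tofrac1 fracDE ?oner_eq0 //.
by rewrite d1 mulr0 subr0 mulr1 expr1n tofrac1 divr1.
Qed.

Lemma fracDD : {morph fracD d : u v / u + v}.
Proof.
move=> u v; rewrite (fracP u) (fracP v).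
have := denom_ratioP (repr u); have := denom_ratioP (repr v).
move: (\n_(repr u)) (\d_(repr u)) (\n_(repr v)) (\d_(repr v)).
move=> p q p' q' q'0 q0.
have [Q Q'] : q%:F != 0 /\ q'%:F != 0 by rewrite !tofrac_eq0.
rewrite addf_div // -!tofracM -tofracD !fracDE ?mulf_neq0 //.
rewrite addf_div ?tofrac_eq0 ?expf_neq0 // -!tofracM -tofracD -exprMn.
by congr (_ %:F / _ %:F); rewrite dD !dM; ring.
Qed.

Lemma fracDM u v : fracD d (u * v) = fracD d u * v + u * fracD d v.
Proof.
rewrite (fracP u) (fracP v).
have := denom_ratioP (repr u); have := denom_ratioP (repr v).
move: (\n_(repr u)) (\d_(repr u)) (\n_(repr v)) (\d_(repr v)).
move=> p q p' q' q'0 q0.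
have [Q Q'] : q%:F != 0 /\ q'%:F != 0 by rewrite !tofrac_eq0.
rewrite mulf_div // -!tofracM !fracDE ?mulf_neq0 //.
rewrite !mulf_div -!tofracM addf_div ?tofrac_eq0 ?mulf_neq0 ?expf_neq0 //.
rewrite -!tofracM -tofracD; apply/eqP.
rewrite eqr_div ?tofrac_eq0 ?mulf_neq0 ?expf_neq0 ?mulf_neq0 // -!tofracM.
by rewrite tofrac_eq !dM; apply/eqP; ring.
Qed.

Lemma fracDV u : fracD d u^-1 = - (fracD d u / u ^+ 2).
Proof.
have d0 : fracD d 0 = 0 by apply: (addIr (fracD d 0)); rewrite -fracDD !add0r.
have [->|u0] := eqVneq u 0; first by rewrite invr0 d0 mul0r oppr0.
have d1 : fracD d 1 = 0.
  by apply: (addIr (fracD d 1)); rewrite add0r -{3}[1]mulr1 fracDM mulr1 mul1r.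
have : fracD d (u * u^-1) = 0 by rewrite divff.
rewrite fracDM => /eqP; rewrite addrC addr_eq0 => /eqP E.
apply: (mulfI u0); rewrite E; field; exact: u0.
Qed.

End One.

Lemma fracDC (d e : A -> A) (u : {fraction A}) :
  {morph d : x y / x + y} -> (forall x y, d (x * y) = d x * y + x * d y) ->
  {morph e : x y / x + y} -> (forall x y, e (x * y) = e x * y + x * e y) ->
  (forall x, d (e x) = e (d x)) ->
  fracD d (fracD e u) = fracD e (fracD d u).
Proof.
move=> dD dM eD eM de; rewrite (fracP u).
have := denom_ratioP (repr u); move: (\n_(repr u)) (\d_(repr u)) => p q q0.
have BE k : {morph k : x y / x + y :> A} -> forall x y, k (x - y) = k x - k y.
  move=> kD x y; rewrite kD; congr (_ + _); apply: (addIr (k y)).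
  by rewrite -kD !addNr; apply: (addIr (k 0)); rewrite -kD !add0r.
rewrite !fracDE ?expf_neq0 //; congr (_ %:F / _).
by rewrite !expr2 !BE // !(dM, eM) !de; ring.
Qed.

End FracD.

(* A[1/h] as a subring of the fraction field (for h <> 0). *)
Definition inloc (A : idomainType) (h : A) : {pred {fraction A}} :=
  fun u => `[< exists k p, u * tofrac h ^+ k = tofrac p >].

Section LocalizationRing.
Variables (A : idomainType) (h : A).
Local Notation "x %:F" := (@FracField.tofrac A x).

Record loc := Loc { loc_val : {fraction A}; loc_valP : loc_val \in inloc h }.

HB.instance Definition _ := [isSub for loc_val].
HB.instance Definition _ := [Choice of loc by <:].

Lemma inlocP u : reflect (exists k p, u * h%:F ^+ k = p%:F) (u \in inloc h).
Proof. exact: asboolP. Qed.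

Fact inloc_subring : subring_closed (inloc h).
Proof.
split=> [|u v /inlocP[k [p E]] /inlocP[l [q F]]|
          u v /inlocP[k [p E]] /inlocP[l [q F]]]; apply/inlocP.
- by exists 0, 1; rewrite expr0 mulr1 tofrac1.
- exists (k + l)%N, (p * h ^+ l - q * h ^+ k).
  by rewrite tofracB !tofracM !tofracXn -E -F exprD; ring.
- by exists (k + l)%N, (p * q); rewrite tofracM -E -F exprD; ring.
Qed.

HB.instance Definition _ := GRing.isSubringClosed.Build {fraction A} (inloc h)
  inloc_subring.
HB.instance Definition _ := [SubChoice_isSubComNzRing of loc by <:].

Fact loc_of_subproof p : p%:F \in inloc h.
Proof. by apply/inlocP; exists 0, p; rewrite expr0 mulr1. Qed.

Definition loc_of p : loc := Loc (loc_of_subproof p).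

Fact loc_of_is_zmod_morphism : zmod_morphism loc_of.
Proof. by move=> p q; apply: val_inj; rewrite rmorphB /= tofracB. Qed.

Fact loc_of_is_monoid_morphism : monoid_morphism loc_of.
Proof.
split=> [|p q]; apply: val_inj; first by rewrite rmorph1 /= tofrac1.
by rewrite rmorphM /= tofracM.
Qed.

HB.instance Definition _ := GRing.isZmodMorphism.Build A loc loc_of
  loc_of_is_zmod_morphism.
HB.instance Definition _ := GRing.isMonoidMorphism.Build A loc loc_of
  loc_of_is_monoid_morphism.

Definition loc_scale (a : A) (u : loc) : loc := loc_of a * u.

Fact loc_scalerA a b u : loc_scale a (loc_scale b u) = loc_scale (a * b) u.
Proof. by rewrite /loc_scale rmorphM mulrA. Qed.

Fact loc_scale1r : left_id 1 loc_scale.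
Proof. by move=> u; rewrite /loc_scale rmorph1 mul1r. Qed.

Fact loc_scalerDr : right_distributive loc_scale +%R.
Proof. by move=> a u v; rewrite /loc_scale mulrDr. Qed.

Fact loc_scalerDl u : {morph loc_scale^~ u : a b / a + b}.
Proof. by move=> a b; rewrite /loc_scale rmorphD mulrDl. Qed.

HB.instance Definition _ := GRing.Zmodule_isLmodule.Build A loc
  loc_scalerA loc_scale1r loc_scalerDr loc_scalerDl.

End LocalizationRing.

Section LocDerivation.
Variables (n : nat) (K : idomainType) (h : {mpoly K[n]}).
Local Notation "x %:F" := (tofrac x).
Implicit Types u v : loc h.

Lemma inloc_fracD i (u : {fraction {mpoly K[n]}}) :
  u \in inloc h -> fracD (mderiv i) u \in inloc h.
Proof.
move=> /inlocP[k [p E]]; apply/inlocP.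
have dD := @mderivD n K i; have dM := @mderivM n K i.
have dX l : fracD (mderiv i) (h%:F ^+ l) * h%:F = h%:F ^+ l *+ l * (h^`M(i))%:F.
  elim: l => [|l IH].
    by rewrite expr0 -tofrac1 fracD_tofrac // -mpolyC1 mderivC tofrac0 mulr0n !mul0r.
  rewrite exprS fracDM // mulrDl fracD_tofrac //.
  rewrite -[h%:F * fracD _ _ * _]mulrA IH mulrS; ring.
exists k.+1, (p^`M(i) * h - p *+ k * h^`M(i)).
have := fracDM dM u (h%:F ^+ k); rewrite E fracD_tofrac // => F.
rewrite tofracB !tofracM tofracMn -E F exprS mulrDl.
rewrite -[u * fracD _ _ * _]mulrA dX; ring.
Qed.

Definition loc_d (i : 'I_n) (u : loc h) : loc h := Loc (inloc_fracD i (valP u)).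

Lemma loc_dD i : {morph loc_d i : u v / u + v}.
Proof. by move=> u v; apply: val_inj; rewrite /= fracDD //; [exact: mderivD|exact: mderivM]. Qed.

Lemma loc_dM i u v : loc_d i (u * v) = loc_d i u * v + u * loc_d i v.
Proof. by apply: val_inj; rewrite /= fracDM //; exact: mderivM. Qed.

Lemma loc_d_of i p : loc_d i (loc_of h p) = loc_of h p^`M(i).
Proof. by apply: val_inj; rewrite /= fracD_tofrac //; exact: mderivM. Qed.

Lemma loc_dC i j u : loc_d i (loc_d j u) = loc_d j (loc_d i u).
Proof.
apply: val_inj; rewrite /= fracDC //; try exact: mderivD; try exact: mderivM.
by move=> p; rewrite mderiv_comm.
Qed.

End LocDerivation.

(* The free rank-one module K[x,1/(fg)] f^a g^b; the exponents, which do not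
   affect the underlying group, only select the action below, and
   [twist a b u] is u f^a g^b. *)
Definition twisted (n : nat) (K : idomainType) (f g : {mpoly K[n]})
  (a b : K) : Type := loc (f * g).

Definition twist (n : nat) (K : idomainType) (f g : {mpoly K[n]})
  (a b : K) (u : loc (f * g)) : twisted f g a b := u.

Section TwistedModule.
Variables (n : nat) (K : idomainType) (f g : {mpoly K[n]}) (a b : K).
Local Notation "x %:F" := (tofrac x).

Fact inloc_invf : f%:F^-1 \in inloc (f * g).
Proof.
apply/inlocP; have [->|f0] := eqVneq f 0.
  by exists 0, 0; rewrite tofrac0 invr0 mul0r.
by exists 1, g; rewrite expr1 tofracM mulKf // tofrac_eq0.
Qed.

Fact inloc_invg : g%:F^-1 \in inloc (f * g).
Proof.
apply/inlocP; have [->|g0] := eqVneq g 0.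
  by exists 0, 0; rewrite tofrac0 invr0 mul0r.
by exists 1, f; rewrite expr1 tofracM mulrC mulfK // tofrac_eq0.
Qed.

Definition loc_invf : loc (f * g) := Loc inloc_invf.
Definition loc_invg : loc (f * g) := Loc inloc_invg.

Lemma loc_d_invf i : loc_d i loc_invf = - loc_of (f * g) f^`M(i) * loc_invf ^+ 2.
Proof.
apply: val_inj; rewrite rmorphM rmorphN rmorphXn /= fracDV; last exact: mderivM.
  by rewrite fracD_tofrac ?mulNr ?exprVn //; exact: mderivM.
exact: mderivD.
Qed.

Lemma loc_d_invg i : loc_d i loc_invg = - loc_of (f * g) g^`M(i) * loc_invg ^+ 2.
Proof.
apply: val_inj; rewrite rmorphM rmorphN rmorphXn /= fracDV; last exact: mderivM.
  by rewrite fracD_tofrac ?mulNr ?exprVn //; exact: mderivM.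
exact: mderivD.
Qed.

(* The action of d_i on K[x,1/(fg)] f^a g^b. *)
Definition dtwist (i : 'I_n) (u : loc (f * g)) : loc (f * g) :=
  loc_d i u + loc_of _ a%:MP * u * (loc_of _ f^`M(i) * loc_invf)
            + loc_of _ b%:MP * u * (loc_of _ g^`M(i) * loc_invg).

Fact dtwistD i : {morph dtwist i : u v / u + v}.
Proof. by move=> u v; rewrite /dtwist loc_dD; ring. Qed.

Fact dtwistZ i (c : {mpoly K[n]}) u :
  dtwist i (c *: u) = c^`M(i) *: u + c *: dtwist i u.
Proof.
rewrite /dtwist -[c *: u]/(loc_of _ c * u) -[_ *: u]/(loc_of _ _ * u).
rewrite -[_ *: _ in RHS]/(loc_of _ _ * _) loc_dM loc_d_of; ring.
Qed.

Fact dtwistC i j u : dtwist i (dtwist j u) = dtwist j (dtwist i u).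
Proof.
rewrite /dtwist !(loc_dD, loc_dM, loc_d_invf, loc_d_invg, loc_d_of) !mderivC.
by rewrite (loc_dC i j) ![_^`M(i)^`M(j)]mderiv_comm rmorph0; ring.
Qed.

Local Notation T := (twisted f g a b).

HB.instance Definition _ := GRing.Zmodule.copy T (loc (f * g)).

Definition twisted_scale (P : weyl n K) (u : T) : T :=
  opact dtwist P u.

Fact twisted_scalerA P Q u :
  twisted_scale P (twisted_scale Q u) = twisted_scale (P * Q) u.
Proof. by apply: esym; exact: (opactM dtwistD dtwistZ dtwistC). Qed.

Fact twisted_scale1r : left_id 1 twisted_scale.
Proof. by move=> u; apply: opact1l. Qed.

Fact twisted_scalerDr : right_distributive twisted_scale +%R.
Proof. by move=> P u v; apply: opactDr; exact: dtwistD. Qed.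

Fact twisted_scalerDl u : {morph twisted_scale^~ u : P Q / P + Q}.
Proof. by move=> P Q; apply: opactDl. Qed.

HB.instance Definition _ := GRing.Zmodule_isLmodule.Build (weyl n K) T
  twisted_scalerA twisted_scale1r twisted_scalerDr twisted_scalerDl.

Lemma twisted_poly p u : weyl_poly p *: twist a b u = twist a b (loc_of _ p * u).
Proof. exact: opact_poly. Qed.

Lemma twisted_d i u : weyl_d K i *: twist a b u = twist a b (dtwist i u).
Proof. by apply: opact_d; exact: dtwistC. Qed.

End TwistedModule.

Section Annihilators.
Variables (R : realType) (n : nat).
Local Notation C := (R[i]).
Local Notation Cs := {poly C}.
Local Notation Cs1s2 := {mpoly C[2]}.
Implicit Types f g : {mpoly C[n]}.

Definition s1 : Cs1s2 := 'X_ord0.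
Definition s2 : Cs1s2 := 'X_ord_max.

Definition to_s f : {mpoly Cs[n]} := map_mpoly (@polyC C) f.
Definition to_s1s2 f : {mpoly Cs1s2[n]} := map_mpoly (@mpolyC 2 C) f.

(* C[x,s,1/(fg)] (f/g)^s, as f^s g^(-s) *)
Definition fg_s f g : lmodType (weyl n Cs) :=
  twisted (to_s f) (to_s g) 'X (- 'X).

(* C[x,s1,s2,1/(fg)] f^s1 g^s2 *)
Definition fg_s1s2 f g : lmodType (weyl n Cs1s2) :=
  twisted (to_s1s2 f) (to_s1s2 g) s1 s2.

Definition Ann (D : nzRingType) (M : lmodType D) (u : M) : set D :=
  [set P | P *: u = 0].

(* I_m(s), the annihilator of g^-m (f/g)^s *)
Definition annIm f g (m : nat) : set (weyl n Cs) :=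
  Ann (twist 'X (- 'X) (loc_invg (to_s f) (to_s g) ^+ m) : fg_s f g).

(* I(s1,s2), the annihilator of f^s1 g^s2 *)
Definition annI f g : set (weyl n Cs1s2) :=
  Ann (twist s1 s2 1 : fg_s1s2 f g).

(* b(p,q) for b in C[s1,s2] *)
Definition subst_s (p q : Cs) (b : Cs1s2) : Cs :=
  mmap (@polyC C) (fun j : 'I_2 => if j == ord0 then p else q) b.

(* The induced substitution D[s1,s2] -> D[s]; it is onto when s1 is sent to s,
   so that it maps left ideals to left ideals. *)
Definition weyl_subst (p q : Cs) (P : weyl n Cs1s2) : weyl n Cs :=
  map_mpoly (map_mpoly (subst_s p q)) P.

(* I(s,-s-m) *)
Definition annI_subst f g (m : nat) : set (weyl n Cs) :=
  [set weyl_subst 'X (- 'X - m%:R) P | P in annI f g].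

Definition Sat_Cs (I : set (weyl n Cs)) : set (weyl n Cs) :=
  [set P | exists q : Cs, q != 0 /\ I (weyl_const n q * P)].

(* B_{f,g}; the vector f^(s1+1) g^(s2+1) is fg f^s1 g^s2. *)
Definition BernsteinSato f g : set Cs1s2 :=
  [set b | exists P : weyl n Cs1s2,
     weyl_const n b *: (twist s1 s2 1 : fg_s1s2 f g) =
     P *: (twist s1 s2 (loc_of _ (to_s1s2 f * to_s1s2 g)) : fg_s1s2 f g)].

Definition C_condition (m : nat) (B : set Cs1s2) : Prop :=
  exists b, B b /\ forall i : nat, (1 <= i)%N ->
    subst_s ('X - i%:R) (- 'X - m%:R - i%:R) b != 0.

End Annihilators.

(* Main.v *)
From HB Require Import structures.
Require Import Defs.
From mathcomp Require Import all_boot all_order all_algebra ring.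
From mathcomp Require Import boolp classical_sets reals.
From mathcomp Require Import complex mpoly.

(* An operator of [I(s,-s-m)] annihilates [f^s g^(-s-m)] because the action
   commutes with the specialization [s1 = s, s2 = -s-m], and K[x,1/(fg)] has no
   K-torsion, so saturating does not leave the annihilator.

   Conversely, let [P(s)] annihilate [f^s g^(-s-m)].  Then [P(s1) f^s1 g^s2]
   vanishes on the line [l := s1+s2+m = 0], so it equals
   [l p f^(s1-k) g^(s2-k)] for some k and some polynomial p.  Shifting the
   functional equation of b by 1, ..., k and composing gives
   [B f^(s1-k) g^(s2-k) = Q f^s1 g^s2], where B is the product of the
   [b(s1-i,s2-i)] for i = 1, ..., k.  Hence [B P(s1) - l p Q] lies in
   [I(s1,s2)]; on the line it becomes [B(s,-s-m) P(s)], and [B(s,-s-m)] is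
   nonzero by the C_m-condition. *)

Set Implicit Arguments.
Unset Strict Implicit.
Unset Printing Implicit Defensive.

Import GRing.Theory.
Local Open Scope ring_scope.

(** * Operators under linear maps and constants *)

Section OperatorAction.
Variables (n : nat) (K : comNzRingType).

(** Linearity carries [L] past the coefficients of the normal form, the hypothesis past each
    derivative. In use, [L] multiplies by a constant or by negative powers of f and g. *)
Lemma opact_morph (M M' : lmodType {mpoly K[n]}) (nabla : 'I_n -> M -> M)
    (nabla' : 'I_n -> M' -> M') (L : {linear M -> M'}) :
  (forall i u, L (nabla i u) = nabla' i (L u)) ->
  forall P u, L (opact nabla P u) = opact nabla' P (L u).
Proof.
move=> LE P u; rewrite /opact linear_sum; apply: eq_bigr => a _.
rewrite linearZ_LR; congr (_ *: _); rewrite /dpow.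
by elim: (enum _) => //= i s <-; elim: (a i) => //= k <-.
Qed.

(** A constant stands to the left of all derivatives, so the Weyl product agrees here with the
    commutative product of normal forms, for which [map_mpoly] is a ring morphism. *)
Lemma weyl_constM c (P : weyl n K) : weyl_const n c * P = c%:MP%:MP * P
    :> {mpoly {mpoly K[n]}[n]}.
Proof. by rewrite mul_mpolyC; apply: opact_poly. Qed.

End OperatorAction.

(** * Multiplication and derivations on K[x,1/h] *)

Section Localization.
Variables (n : nat) (K : idomainType) (h : {mpoly K[n]}).

(** A named form of the product, to carry the linear structure that [opact_morph] asks for. *)
Definition loc_mul (w : loc h) : loc h -> loc h := *%R w.

Fact loc_mul_is_linear w : linear (loc_mul w).
Proof.
move=> c u v; rewrite /loc_mul mulrDr; congr (_ + _); exact: mulrCA.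
Qed.

HB.instance Definition _ w := GRing.isLinear.Build _ _ _ _ (loc_mul w)
  (loc_mul_is_linear w).

Lemma loc_scaleE (p : {mpoly K[n]}) (u : loc h) : p *: u = loc_of h p * u.
Proof. by []. Qed.

Lemma loc_of_inj : injective (loc_of h).
Proof.
by move=> p q /(congr1 val) /eqP /=; rewrite tofrac_eq => /eqP.
Qed.

Lemma loc_of_lreg p : p != 0 -> GRing.lreg (loc_of h p).
Proof.
move=> p0 u v /(congr1 val); rewrite !rmorphM /= => /mulfI E.
by apply: val_inj; apply: E; rewrite tofrac_eq0.
Qed.

Lemma loc_d1 i : loc_d i (1 : loc h) = 0.
Proof. by rewrite -(rmorph1 (loc_of h)) loc_d_of -mpolyC1 mderivC rmorph0. Qed.

Lemma loc_dX i (u : loc h) k : loc_d i (u ^+ k.+1) = u ^+ k * loc_d i u *+ k.+1.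
Proof.
elim: k => [|k IH]; first by rewrite expr1 expr0 mul1r mulr1n.
rewrite exprS loc_dM IH mulrnAr mulrA -exprS addrC [loc_d i u * _]mulrC.
by rewrite -mulrSr.
Qed.

End Localization.

(** * Multiplication by powers of f and g as a shift of exponents *)

Lemma leibniz_shift (A : comNzRingType) (w dw u du a b a' b' p q : A) :
  dw = (a - a') * w * p + (b - b') * w * q ->
  w * (du + a * u * p + b * u * q)
    = dw * u + w * du + a' * (w * u) * p + b' * (w * u) * q.
Proof. move=> ->; ring. Qed.

(** With [v] = 1/p and [y] a derivative of p, this is the logarithmic derivative of p^-(k+1). *)
Lemma log_derivX (A : comNzRingType) (y v : A) k :
  v ^+ k * (- y * v ^+ 2) *+ k.+1 = - k.+1%:R * v ^+ k.+1 * (y * v).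
Proof.
by rewrite [v ^+ k.+1]exprS -mulr_natl; move: (v ^+ k) k.+1%:R => x c; ring.
Qed.

(** The product rule for f^-c g^-c: [x], [y] are the two powers and [p], [q] the logarithmic
    derivatives of f and g. *)
Lemma log_derivM (A : comNzRingType) (a b c x y p q : A) :
  - c * x * p * y + x * (- c * y * q)
    = (a - c - a) * (x * y) * p + (b - c - b) * (x * y) * q.
Proof. ring. Qed.

Section Shift.
Variables (n : nat) (K : idomainType) (f g : {mpoly K[n]}).
Hypotheses (f0 : f != 0) (g0 : g != 0).

Lemma loc_invfK : loc_of _ f * loc_invf f g = 1.
Proof. by apply: val_inj; rewrite rmorphM rmorph1 /= divff // tofrac_eq0. Qed.

Lemma loc_invgK : loc_of _ g * loc_invg f g = 1.
Proof. by apply: val_inj; rewrite rmorphM rmorph1 /= divff // tofrac_eq0. Qed.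

(* The hypothesis says that [w] is [f^(a - a') g^(b - b')], up to a constant. *)
Lemma dtwist_shift (a b a' b' : K) (w : loc (f * g)) :
  (forall i, loc_d i w
    = (loc_of _ a%:MP - loc_of _ a'%:MP) * w * (loc_of _ f^`M(i) * loc_invf f g)
      + (loc_of _ b%:MP - loc_of _ b'%:MP) * w * (loc_of _ g^`M(i) * loc_invg f g)) ->
  forall P u, loc_mul w (opact (dtwist a b) P u)
    = opact (dtwist a' b') P (loc_mul w u).
Proof.
move=> H.
have LE i u : loc_mul w (dtwist a b i u) = dtwist a' b' i (loc_mul w u).
  rewrite /loc_mul /dtwist.
  rewrite (loc_dM i w u).
  exact: (leibniz_shift _ _ (H i)).
exact: (opact_morph LE).
Qed.

Lemma opact_const c a b P u :
  loc_mul (loc_of (f * g) c%:MP) (opact (dtwist a b) P u)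
    = opact (dtwist a b) P (loc_mul (loc_of _ c%:MP) u).
Proof.
apply: dtwist_shift => i.
by rewrite loc_d_of mderivC rmorph0 !subrr !mul0r addr0.
Qed.

Lemma loc_d_invX (v : loc (f * g)) (p : {mpoly K[n]}) i k :
  loc_d i v = - loc_of _ p * v ^+ 2 ->
  loc_d i (v ^+ k) = - loc_of _ k%:R * v ^+ k * (loc_of _ p * v).
Proof.
move=> E; case: k => [|k]; first by rewrite expr0 loc_d1 rmorph0 oppr0 !mul0r.
rewrite loc_dX E (rmorph_nat (loc_of _)).
exact: log_derivX.
Qed.

(** The factor g^-m is g^((b-m)-b), a weight of the form that [dtwist_shift] handles. *)
Lemma opact_shift_g a b m P u :
  loc_mul (loc_invg f g ^+ m) (opact (dtwist a (b - m%:R)) P u)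
    = opact (dtwist a b) P (loc_mul (loc_invg f g ^+ m) u).
Proof.
apply: dtwist_shift => i; rewrite (loc_d_invX _ (loc_d_invg f g i)) subrr !mul0r add0r.
by rewrite mpolyCB rmorphB addrAC subrr add0r mpolyCMn.
Qed.

Lemma opact_shift_fg a b m P u :
  loc_mul (loc_invf f g ^+ m * loc_invg f g ^+ m)
      (opact (dtwist (a - m%:R) (b - m%:R)) P u)
    = opact (dtwist a b) P (loc_mul (loc_invf f g ^+ m * loc_invg f g ^+ m) u).
Proof.
apply: dtwist_shift => i; rewrite loc_dM.
rewrite (loc_d_invX _ (loc_d_invg f g i)) (loc_d_invX _ (loc_d_invf f g i)).
rewrite !mpolyCB !rmorphB !mpolyCMn.
move: (loc_invf f g ^+ m) (loc_invg f g ^+ m) => x y.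
exact: log_derivM.
Qed.

End Shift.

(** * Specialization of the parameters *)

Lemma mderiv_map_mpoly (n : nat) (K K' : nzRingType) (phi : {rmorphism K -> K'})
    (p : {mpoly K[n]}) i :
  map_mpoly phi p^`M(i) = (map_mpoly phi p)^`M(i).
Proof.
apply/mpolyP=> m.
by rewrite mcoeff_map_mpoly !mcoeff_deriv mcoeff_map_mpoly raddfMn.
Qed.

Section FractionArithmetic.
Variable A : comNzRingType.
Implicit Types h u v p q : A.

(** The common numerator is a polynomial formula in [p], [q] and [h], so a ring morphism carries it
    to the numerator on the other side of [specializes]. *)
Lemma clear_denomD h u v p q k l : u * h ^+ k = p -> v * h ^+ l = q ->
  (u + v) * h ^+ (k + l) = p * h ^+ l + q * h ^+ k.
Proof. by move=> <- <-; rewrite exprD; move: (h ^+ k) (h ^+ l) => x y; ring. Qed.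

Lemma clear_denomM h u v p q k l : u * h ^+ k = p -> v * h ^+ l = q ->
  (u * v) * h ^+ (k + l) = p * q.
Proof. by move=> <- <-; rewrite exprD; move: (h ^+ k) (h ^+ l) => x y; ring. Qed.

(** The quotient rule for p/h^k. The extra factor [h] in the last hypothesis avoids the exponent
    k-1, so that k = 0 is no exception. *)
Lemma clear_denom_deriv h dh u du p dp k (d : A -> A) :
  u * h ^+ k = p -> dp = du * h ^+ k + u * d (h ^+ k) ->
  d (h ^+ k) * h = k%:R * h ^+ k * dh ->
  du * h ^+ k.+1 = dp * h - k%:R * p * dh.
Proof.
move=> <- -> E; rewrite mulrDl -[u * _ * h]mulrA E exprSr.
by move: (h ^+ k) k%:R => x c; ring.
Qed.

End FractionArithmetic.

Lemma rmorph_add_den (A B : nzRingType) (F : {rmorphism A -> B}) p q r k l :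
  F (p * r ^+ l + q * r ^+ k) = F p * F r ^+ l + F q * F r ^+ k.
Proof. by rewrite rmorphD !rmorphM !rmorphXn. Qed.

Lemma rmorph_deriv_den (A B : nzRingType) (F : {rmorphism A -> B}) dp p r dr k :
  F (dp * r - k%:R * p * dr) = F dp * F r - k%:R * F p * F dr.
Proof. by rewrite rmorphB !rmorphM rmorph_nat. Qed.

Section Specialization.
Variables (n : nat) (K K' : idomainType) (phi : {rmorphism K -> K'}).
Variables (f g : {mpoly K[n]}) (f' g' : {mpoly K'[n]}).
Hypotheses (fE : map_mpoly phi f = f') (gE : map_mpoly phi g = g').
Hypotheses (f0 : f != 0) (g0 : g != 0) (f'0 : f' != 0) (g'0 : g' != 0).

Local Notation h := (f * g).
Local Notation h' := (f' * g').

(* [u'] is the image of [u] under [phi].  A relation rather than a function: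
   when [phi] has a kernel, it does not extend to the fraction fields in which
   [loc] lives. *)
Definition specializes (u : loc h) (u' : loc h') : Prop :=
  exists k p, u * loc_of h h ^+ k = loc_of h p
    /\ u' * loc_of h' h' ^+ k = loc_of h' (map_mpoly phi p).

Lemma map_h : map_mpoly phi h = h'.
Proof. by rewrite rmorphM /= fE gE. Qed.

Lemma specializes_of p : specializes (loc_of h p) (loc_of h' (map_mpoly phi p)).
Proof. by exists 0, p; rewrite !expr0 !mulr1. Qed.

Lemma specializes1 : specializes 1 1.
Proof. by have := specializes_of 1; rewrite !rmorph1. Qed.

Lemma specializes_polyC c :
  specializes (loc_of h c%:MP) (loc_of h' (phi c)%:MP).
Proof. by have := specializes_of c%:MP; rewrite map_mpolyC. Qed.

Lemma specializesD u u' v v' : specializes u u' -> specializes v v' ->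
  specializes (u + v) (u' + v').
Proof.
move=> [k [p [E E']]] [l [q [F F']]].
exists (k + l)%N, (p * h ^+ l + q * h ^+ k).
rewrite (clear_denomD E F) (clear_denomD E' F').
by rewrite (rmorph_add_den (map_mpoly phi)) /= map_h !(rmorph_add_den (loc_of _)).
Qed.

Lemma specializesM u u' v v' : specializes u u' -> specializes v v' ->
  specializes (u * v) (u' * v').
Proof.
move=> [k [p [E E']]] [l [q [F F']]].
exists (k + l)%N, (p * q).
by rewrite (clear_denomM E F) (clear_denomM E' F') !rmorphM.
Qed.

Lemma loc_d_den (L : idomainType) (r : {mpoly L[n]}) i k :
  loc_d i (loc_of r r ^+ k) * loc_of r r
    = k%:R * loc_of r r ^+ k * loc_of r r^`M(i).
Proof.
case: k => [|k]; first by rewrite expr0 loc_d1 !mul0r.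
rewrite loc_dX loc_d_of exprS -mulr_natl.
by move: (loc_of r r) (loc_of r _) => x z; move: (x ^+ k) => y; ring.
Qed.

Lemma loc_d_clear (L : idomainType) (r : {mpoly L[n]}) i (u : loc r) k p :
  u * loc_of r r ^+ k = loc_of r p ->
  loc_d i u * loc_of r r ^+ k.+1 = loc_of r (p^`M(i) * r - k%:R * p * r^`M(i)).
Proof.
move=> E; have := congr1 (loc_d i) E; rewrite loc_d_of loc_dM => F.
rewrite (clear_denom_deriv E (esym F) (loc_d_den r i k)).
by rewrite (rmorph_deriv_den (loc_of _)).
Qed.

Lemma specializes_d i u u' : specializes u u' -> specializes (loc_d i u) (loc_d i u').
Proof.
move=> [k [p [E E']]]; exists k.+1, (p^`M(i) * h - k%:R * p * h^`M(i)).
rewrite (loc_d_clear i E) (loc_d_clear i E'); split=> //; congr (loc_of _ _).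
by rewrite (rmorph_deriv_den (map_mpoly phi)) /= !mderiv_map_mpoly map_h.
Qed.

Lemma specializes_invf : specializes (loc_invf f g) (loc_invf f' g').
Proof.
(* 1/f = g/(fg). *)
exists 1%N, g; rewrite !expr1 gE !(rmorphM (loc_of _)) !mulrA.
by rewrite ![loc_invf _ _ * _]mulrC !loc_invfK // !mul1r.
Qed.

Lemma specializes_invg : specializes (loc_invg f g) (loc_invg f' g').
Proof.
exists 1%N, f; rewrite !expr1 fE !(rmorphM (loc_of _)).
by rewrite ![loc_invg _ _ * _]mulrC -!mulrA !loc_invgK // !mulr1.
Qed.

Lemma specializes_dtwist a b i u u' : specializes u u' ->
  specializes (dtwist a b i u) (dtwist (phi a) (phi b) i u').
Proof.
move=> uu'; apply: specializesD; first apply: specializesD.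
- exact: specializes_d.
- apply: specializesM; first by apply: specializesM => //; exact: specializes_polyC.
  apply: specializesM; last exact: specializes_invf.
  by have := specializes_of f^`M(i); rewrite mderiv_map_mpoly fE.
- apply: specializesM; first by apply: specializesM => //; exact: specializes_polyC.
  apply: specializesM; last exact: specializes_invg.
  by have := specializes_of g^`M(i); rewrite mderiv_map_mpoly gE.
Qed.

Lemma specializes_opact a b (P : {mpoly {mpoly K[n]}[n]}) u u' :
  specializes u u' ->
  specializes (opact (dtwist a b) P u)
    (opact (dtwist (phi a) (phi b)) (map_mpoly (map_mpoly phi) P) u').
Proof.
(* Both sides become sums over [msupp P]; the mapped operator may have a smaller support, so the two
   [opact] sums would not match term by term. *)
move=> uu'; rewrite {2}[P]mpolyE raddf_sum opact_suml {1}/opact.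
apply: (big_ind2 specializes) => [||a0 _].
- by have := specializes_of 0; rewrite !raddf0.
- by move=> *; exact: specializesD.
rewrite /= map_mpolyZ map_mpolyX opactZl opactX.
apply: specializesM; first exact: specializes_of.
rewrite /dpow; elim: (enum _) => //= i s; elim: (a0 i) => //= k IH sE.
exact/specializes_dtwist/IH.
Qed.

(** The numerator of 0 is 0, hence so is its image, and h'^k is regular since f' and g' are
    nonzero. *)
Lemma specializes0 u' : specializes 0 u' -> u' = 0.
Proof.
move=> [k [p [/esym]]]; rewrite mul0r -(rmorph0 (loc_of h)) => /loc_of_inj -> E.
have h'0 : h' ^+ k != 0 by rewrite expf_neq0 ?mulf_neq0.
by apply: (loc_of_lreg h'0); rewrite mulr0 [_ * u']mulrC rmorphXn E !rmorph0.
Qed.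

(** In this direction [u] need not vanish: only the image of its numerator does. The factor s1+s2+m
    will come from there. *)
Lemma specializes_to0 u : specializes u 0 ->
  exists k p, u * loc_of h h ^+ k = loc_of h p /\ map_mpoly phi p = 0.
Proof.
move=> [k [p [E /esym]]]; rewrite mul0r -(rmorph0 (loc_of h')) => /loc_of_inj F.
by exists k, p.
Qed.

End Specialization.

(** * Coefficientwise ring morphisms and their kernels *)

Lemma mpoly_gen_ind (n : nat) (K : comNzRingType) (Pr : {mpoly K[n]} -> Prop) :
  (forall c, Pr c%:MP) -> (forall i, Pr 'X_i) ->
  (forall p q, Pr p -> Pr q -> Pr (p + q)) ->
  (forall p q, Pr p -> Pr q -> Pr (p * q)) ->
  forall p, Pr p.
Proof.
move=> PC PX PD PM p; rewrite [p]mpolyE; apply: big_ind => // [|m _].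
  by rewrite -mpolyC0.
rewrite -mul_mpolyC; apply: (PM) => //; rewrite mpolyXE_id.
apply: big_ind => // [|i _]; first by rewrite -mpolyC1.
elim: (m i) => [|k IH]; first by rewrite expr0 -mpolyC1.
by rewrite exprS; apply: PM.
Qed.

(** Each coefficient lies in the kernel of [phi]; the quotients by [l] are the coefficients of
    p'. *)
Lemma map_mpoly_kernel (n : nat) (K K' : comNzRingType)
    (phi : {rmorphism K -> K'}) (l : K) (p : {mpoly K[n]}) :
  (forall c, phi c = 0 -> exists c', c = l * c') ->
  map_mpoly phi p = 0 -> exists p', p = l%:MP * p'.
Proof.
move=> kerE p0; rewrite [p]mpolyE.
apply: (big_ind (fun q => exists p', q = l%:MP * p'))
    => [|_ _ [x ->] [y ->]|m _]; first by exists 0; rewrite mulr0.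
  by exists (x + y); rewrite mulrDr.
have [|c ->] := kerE p@_m; first by rewrite -mcoeff_map_mpoly p0 mcoeff0.
by exists (c *: 'X_[m]); rewrite mul_mpolyC scalerA.
Qed.

Lemma map_mpoly_ext (n : nat) (K K' L : nzRingType) (phi : {rmorphism K -> K'})
    (psi : {rmorphism K' -> L}) (chi : {rmorphism K -> L}) (p : {mpoly K[n]}) :
  (forall c, psi (phi c) = chi c) ->
  map_mpoly psi (map_mpoly phi p) = map_mpoly chi p.
Proof. by move=> E; apply/mpolyP=> a; rewrite !mcoeff_map_mpoly; apply: E. Qed.

Lemma map_mpoly_id (n : nat) (K K' : nzRingType) (phi : {rmorphism K -> K'})
    (psi : {rmorphism K' -> K}) (p : {mpoly K[n]}) :
  cancel phi psi -> map_mpoly psi (map_mpoly phi p) = p.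
Proof. by move=> phiK; apply/mpolyP=> a; rewrite !mcoeff_map_mpoly; apply: phiK. Qed.

(** * Substitutions for s1 and s2 *)

Section Substitutions.
Variable C : idomainType.
Local Notation Cs := {poly C}.
Local Notation Cs1s2 := {mpoly C[2]}.

Definition shift (i : nat) : {rmorphism Cs1s2 -> Cs1s2} :=
  mmap (@mpolyC 2 C) (fun j => 'X_j - i%:R).

Definition lift_s1 : {rmorphism Cs -> Cs1s2} :=
  horner_eval ('X_ord0 : Cs1s2) \o map_poly (@mpolyC 2 C).

Lemma shiftC i c : shift i c%:MP = c%:MP.
Proof. exact: mmapC. Qed.

Lemma shiftX i j : shift i 'X_j = 'X_j - i%:R.
Proof. by rewrite /shift /= mmapX mmap1U. Qed.

Lemma lift_s1C c : lift_s1 c%:P = c%:MP.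
Proof. by rewrite /= map_polyC /horner_eval hornerC. Qed.

Lemma lift_s1X : lift_s1 'X = 'X_ord0.
Proof. by rewrite /= map_polyX /horner_eval hornerX. Qed.

Lemma lift_s1K (psi : {rmorphism Cs1s2 -> Cs}) :
  (forall c, psi c%:MP = c%:P) -> psi 'X_ord0 = 'X -> cancel lift_s1 psi.
Proof.
move=> psiC psiX; elim/poly_ind => [|p c IH]; first by rewrite !rmorph0.
by rewrite rmorphD rmorphM lift_s1C lift_s1X rmorphD rmorphM psiC psiX IH.
Qed.

(** Modulo s2 - t(s1) the variable s2 may be replaced by t(s1), so every c is congruent to
    [lift_s1 (psi c)]. This congruence is checked on generators. *)
Lemma kernel_subst (psi : {rmorphism Cs1s2 -> Cs}) (t : Cs) :
  (forall c, psi c%:MP = c%:P) -> psi 'X_ord0 = 'X -> psi 'X_ord_max = t ->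
  forall c, psi c = 0 -> exists c', c = ('X_ord_max - lift_s1 t) * c'.
Proof.
move=> psiC psiX psiY c c0.
suff [c' E] : exists c', c - lift_s1 (psi c) = ('X_ord_max - lift_s1 t) * c'.
  by exists c'; rewrite -E c0 rmorph0 subr0.
elim/mpoly_gen_ind: c {c0} => [c|i|p q [x E] [y F]|p q [x E] [y F]].
- by exists 0; rewrite psiC lift_s1C subrr mulr0.
- have [->|->] : i = ord0 \/ i = ord_max.
    by case: i => -[|[|//]] ilt; [left|right]; apply: val_inj.
  + by exists 0; rewrite psiX lift_s1X subrr mulr0.
  + by exists 1; rewrite psiY mulr1.
- by exists (x + y); rewrite 2!rmorphD opprD addrACA E F mulrDr.
(* From pq - p'q' = (p - p')q + p'(q - q'), where primes denote the image under [psi] followed by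
   [lift_s1]. *)
- exists (x * q + lift_s1 (psi p) * y); rewrite mulrDr mulrA -E mulrCA -F.
  by rewrite 2!rmorphM; move: (lift_s1 _) (lift_s1 _) => a b; ring.
Qed.

End Substitutions.

Section SubstS.
Variable R : realType.
Local Notation C := (R[i]).

HB.instance Definition _ (p q : {poly C}) := GRing.RMorphism.copy (subst_s p q)
  (mmap (@polyC C) (fun j : 'I_2 => if j == ord0 then p else q)).

Lemma subst_sC (p q : {poly C}) c : subst_s p q c%:MP = c%:P.
Proof. exact: mmapC. Qed.

Lemma subst_sX (p q : {poly C}) j :
  subst_s p q 'X_j = if j == ord0 then p else q.
Proof. by rewrite /subst_s mmapX mmap1U. Qed.

(** Identifies the restricted factors of the iterated functional equation with the polynomials of
    the C_m-condition. Both sides are ring morphisms in [b]. *)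
Lemma subst_s_shift (p q : {poly C}) i b :
  subst_s p q (shift C i b) = subst_s (p - i%:R) (q - i%:R) b.
Proof.
elim/mpoly_gen_ind: b => [c|j|x y E F|x y E F].
- by rewrite shiftC !subst_sC.
- by rewrite shiftX rmorphB rmorph_nat /= !subst_sX; case: ifP.
- by rewrite !rmorphD; congr (_ + _); [exact: E | exact: F].
- by rewrite !rmorphM; congr (_ * _); [exact: E | exact: F].
Qed.

End SubstS.

(** * Powers of 1/(fg) and 1/g as vectors of the twisted module *)

Section LocalizationInverse.
Variables (n : nat) (K : idomainType).

Lemma opactBl (M : lmodType {mpoly K[n]}) (nabla : 'I_n -> M -> M)
    (P Q : weyl n K) u :
  opact nabla (P - Q) u = opact nabla P u - opact nabla Q u.
Proof. by apply/eqP; rewrite eq_sym subr_eq -opactDl subrK. Qed.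

Lemma opact_weyl_const (M : lmodType {mpoly K[n]}) (nabla : 'I_n -> M -> M)
    c (P : weyl n K) u :
  opact nabla (weyl_const n c * P) u = c%:MP *: opact nabla P u.
Proof.
rewrite -opactZl; congr (opact _ _ _); exact: opact_poly.
Qed.

Lemma opact_weyl_const1 (h : {mpoly K[n]}) (nabla : 'I_n -> loc h -> loc h) c :
  opact nabla (weyl_const n c) 1 = loc_of h c%:MP.
Proof. by apply: etrans (opact_poly _ _ _) _; rewrite loc_scaleE mulr1. Qed.

Lemma opact_weylM (f g : {mpoly K[n]}) a b (P Q : weyl n K) (u : loc (f * g)) :
  opact (dtwist a b) (P * Q) u = opact (dtwist a b) P (opact (dtwist a b) Q u).
Proof. exact: (opactM (dtwistD a b) (dtwistZ a b) (@dtwistC n K f g a b)). Qed.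

Variables f g : {mpoly K[n]}.
Hypotheses (f0 : f != 0) (g0 : g != 0).

Definition loc_inv : loc (f * g) := loc_invf f g * loc_invg f g.

Lemma loc_invK : loc_of _ (f * g) * loc_inv = 1.
Proof. by rewrite rmorphM /loc_inv mulrACA loc_invfK // loc_invgK // mul1r. Qed.

Lemma loc_invXK k : loc_of _ (f * g) ^+ k * loc_inv ^+ k = 1.
Proof. by rewrite -exprMn loc_invK expr1n. Qed.

Lemma opact_shift a b k P u :
  loc_inv ^+ k * opact (dtwist (a - k%:R) (b - k%:R)) P u
    = opact (dtwist a b) P (loc_inv ^+ k * u).
Proof. by rewrite exprMn; exact: opact_shift_fg. Qed.

(** Multiplication by g^-m is injective. With a = s and b = -s, the vector g^-m (f/g)^s is thereby
    replaced by f^s g^(-s-m). *)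
Lemma opact_twist_invg a b m P :
  opact (@dtwist n K f g a b) P (loc_invg f g ^+ m) = 0 <->
  opact (@dtwist n K f g a (b - m%:R)) P 1 = 0.
Proof.
have E := opact_shift_g a b m P (1 : loc (f * g)).
rewrite /loc_mul mulr1 in E; rewrite -E.
split=> [F|->]; last by rewrite mulr0.
have := congr1 (fun v => loc_of _ g ^+ m * v) F.
by rewrite mulr0 mulrA -exprMn loc_invgK // expr1n mul1r.
Qed.

End LocalizationInverse.

(** The difference of the two values is a specialization of 0. *)
Lemma specializes_uniq (n : nat) (K K' : idomainType)
    (phi : {rmorphism K -> K'}) (f g : {mpoly K[n]}) (f' g' : {mpoly K'[n]})
    (u : loc (f * g)) (u' u'' : loc (f' * g')) :
  map_mpoly phi f = f' -> map_mpoly phi g = g' -> f' != 0 -> g' != 0 ->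
  specializes phi u u' -> specializes phi u u'' -> u' = u''.
Proof.
move=> fE gE f0 g0 H' [k [p [E F]]].
have N : specializes phi (- u) (- u'').
  by exists k, (- p); rewrite !mulNr E F !rmorphN.
have := specializesD fE gE H' N; rewrite subrr => /(specializes0 f0 g0).
by move/eqP; rewrite subr_eq0 => /eqP.
Qed.

Lemma map_weyl_constM (n : nat) (K K' : comNzRingType)
    (phi : {rmorphism K -> K'}) c (P : weyl n K) :
  map_mpoly (map_mpoly phi) (weyl_const n c * P)
    = weyl_const n (phi c) * (map_mpoly (map_mpoly phi) P : weyl n K').
Proof.
rewrite !weyl_constM (rmorphM (map_mpoly (map_mpoly phi))) /=.
by rewrite map_mpolyC /= map_mpolyC.
Qed.

Lemma map_mpoly_neq0 (n : nat) (K K' : nzRingType) (phi : {rmorphism K -> K'})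
    (p : {mpoly K[n]}) :
  injective phi -> p != 0 -> map_mpoly phi p != 0.
Proof.
move=> phi_inj; apply: contra_neq => p0; apply/mpolyP=> m; apply: phi_inj.
by rewrite mcoeff0 rmorph0 -mcoeff_map_mpoly p0 mcoeff0.
Qed.

(** * Annihilators under specialization, and the iterated functional equation *)

Section FunctionalEquation.
Variables (n : nat) (K K' : idomainType) (psi : {rmorphism K -> K'}).
Variables (f g : {mpoly K[n]}) (f' g' : {mpoly K'[n]}).
Variables (a b : K) (a' b' : K').
Hypotheses (aE : psi a = a') (bE : psi b = b').
Hypotheses (fE : map_mpoly psi f = f') (gE : map_mpoly psi g = g').
Hypotheses (f0 : f != 0) (g0 : g != 0) (f'0 : f' != 0) (g'0 : g' != 0).
Local Notation act := (opact (@dtwist n K f g a b)).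
Local Notation act' := (opact (@dtwist n K' f' g' a' b')).

(** Abstract form of the inclusion of the saturation in the annihilator: specializing [act Q 1 = 0]
    leaves [q] times [act' P 1], and [q] can be cancelled. *)
Lemma specialize_annihilator (q : K') (P : weyl n K') (Q : weyl n K) :
  q != 0 -> map_mpoly (map_mpoly psi) Q = weyl_const n q * P ->
  act Q 1 = 0 -> act' P 1 = 0.
Proof.
rewrite -aE -bE => q0 E Q0.
have := specializes_opact fE gE f0 g0 f'0 g'0 a b Q (specializes1 psi f g f' g').
rewrite E Q0 => /(specializes0 f'0 g'0); rewrite opact_weyl_const loc_scaleE.
rewrite -[X in _ = X](mulr0 (loc_of (f' * g') q%:MP)) => /loc_of_lreg; apply.
by rewrite mpolyC_eq0.
Qed.

Variable shf : nat -> {rmorphism K -> K}.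
Hypotheses (shfF : forall i, map_mpoly (shf i) f = f).
Hypotheses (shfG : forall i, map_mpoly (shf i) g = g).
Hypotheses (shfa : forall i, shf i a = a - i%:R).
Hypotheses (shfb : forall i, shf i b = b - i%:R).
Variables (B : K) (PB : weyl n K).
Hypothesis BE : loc_of (f * g) B%:MP = act PB (loc_of _ (f * g)).

(** The vector [loc_inv f g ^+ i] is f^(a-i) g^(b-i). Shifting [BE] by i+1 gives an equation for
    exponents a-i-1, b-i-1; multiplying by (fg)^-(i+1) rewrites it for the action with exponents a,
    b. *)
Lemma functional_equation_step i : exists P : weyl n K,
  loc_of (f * g) (shf i.+1 B)%:MP * loc_inv f g ^+ i.+1
    = act P (loc_inv f g ^+ i).
Proof.
pose phi := shf i.+1.
have H1 := specializes_opact (shfF i.+1) (shfG i.+1) f0 g0 f0 g0 a b PB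
  (specializes_of phi f g f g (f * g)).
have H2 := specializes_polyC phi f g f g B.
rewrite BE in H2.
(* [specializes] being a relation, the shifted equation is read off from two specializations of one
   vector. *)
have := specializes_uniq (shfF i.+1) (shfG i.+1) f0 g0 H2 H1.
rewrite shfa shfb rmorphM /= shfF shfG => E.
exists (map_mpoly (map_mpoly phi) PB).
rewrite E [LHS]mulrC opact_shift //; congr (opact _ _ _).
by rewrite exprSr -mulrA [_ * loc_of _ _]mulrC loc_invK // mulr1.
Qed.

(** The constants of the first k equations commute with the operator of the next one, so the
    equations compose. *)
Lemma functional_equation_iter k : exists Q : weyl n K,
  loc_of (f * g) (\prod_(i < k) shf i.+1 B)%:MP * loc_inv f g ^+ k = act Q 1.
Proof.
elim: k => [|k [Q E]].
  by exists 1; rewrite big_ord0 expr0 mpolyC1 rmorph1 mulr1 opact1l.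
have [P F'] := functional_equation_step k.
exists (P * Q); rewrite opact_weylM -E big_ord_recr /= mpolyCM rmorphM -mulrA F'.
exact: opact_const.
Qed.

Variables (lift : {rmorphism K' -> K}) (l : K).
Hypotheses (liftK : cancel lift psi) (psil : psi l = 0).
Hypothesis kerE : forall c, psi c = 0 -> exists c', c = l * c'.
Hypothesis shfB : forall i, psi (shf i.+1 B) != 0.

(** Abstract form of the converse inclusion: [lift] stands for s -> s1, [l] for s1+s2+m, and [psi]
    restricts to the line l = 0. *)
Lemma lift_annihilator (P : weyl n K') : act' P 1 = 0 ->
  exists q (Q : weyl n K), [/\ q != 0, act Q 1 = 0
    & map_mpoly (map_mpoly psi) Q = weyl_const n q * P].
Proof.
rewrite -aE -bE => P0; pose P1 : weyl n K := map_mpoly (map_mpoly lift) P.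
have P1E : map_mpoly (map_mpoly psi) P1 = P.
  by apply: map_mpoly_id => p; apply: map_mpoly_id.
have := specializes_opact fE gE f0 g0 f'0 g'0 a b P1 (specializes1 psi f g f' g').
(* The number of shifts k is the exponent of the denominator of [act P1 1]. *)
rewrite P1E P0 => /specializes_to0 [k [p [E p0]]].
have [p' pE] := map_mpoly_kernel kerE p0.
have [Q QE] := functional_equation_iter k.
set c := \prod_(i < k) _ in QE.
(* Since [act P1 1] is l p' (fg)^-k and [c] times (fg)^-k is [act Q 1], the two terms cancel on 1;
   [psi] kills the second term through [l]. *)
exists (psi c), (weyl_const n c * P1 - weyl_const n l * (weyl_poly p' * Q)).
split.
- by rewrite rmorph_prod; apply/prodf_neq0 => i _ /=.
- have uE : act P1 1 = loc_of _ p * loc_inv f g ^+ k.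
    by rewrite -E -mulrA loc_invXK // mulr1.
  have E1 : act (weyl_const n c * P1) 1 = loc_of _ c%:MP * act P1 1.
    exact: opact_weyl_const.
  have E2 : act (weyl_const n l * (weyl_poly p' * Q)) 1
      = loc_of _ l%:MP * act (weyl_poly p' * Q) 1.
    exact: opact_weyl_const.
  have E3 : act (weyl_poly p' * Q) 1 = loc_of _ p' * act Q 1.
    by rewrite opact_weylM opact_poly.
  apply: etrans (opactBl _ _ _ _) _.
  apply: etrans (congr2 (fun x y => x - y) E1 E2) _.
  apply/eqP; rewrite subr_eq0; apply/eqP.
  rewrite E3 -QE uE pE.
  rewrite (rmorphM (loc_of _)).
  by rewrite -[_ * _ * loc_inv _ _ ^+ _]mulrA [LHS]mulrCA [X in _ * X = _]mulrCA.
- have z0 : map_mpoly (map_mpoly psi) (weyl_const n l * (weyl_poly p' * Q)) = 0.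
    apply: etrans (map_weyl_constM _ _ _) _.
    by apply: etrans (weyl_constM _ _) _; rewrite psil !mpolyC0 mul0r.
  have E1 := map_weyl_constM psi c P1; rewrite P1E in E1.
  apply: etrans (raddfB (map_mpoly (map_mpoly psi)) _ _) _.
  by apply: etrans (congr2 (fun x y => x - y) E1 z0) _; rewrite subr0.
Qed.

End FunctionalEquation.

(** * The two inclusions over C[s1,s2] and C[s] *)

Section Main.
Variables (R : realType) (n : nat) (f g : {mpoly R[i][n]}) (m : nat).
Hypotheses (f0 : f != 0) (g0 : g != 0).
Local Notation C := (R[i]).
Local Notation psi := (subst_s 'X (- 'X - m%:R : {poly C})).

Let Ks12 : idomainType := {mpoly C[2]}.
Let Ks : idomainType := {poly C}.
Let phi : {rmorphism Ks12 -> Ks} := psi.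

Let phiF (r : {mpoly C[n]}) : map_mpoly phi (to_s1s2 r) = to_s r.
Proof. exact: (map_mpoly_ext _ (subst_sC _ _)). Qed.

Let shfF i (r : {mpoly C[n]}) : map_mpoly (shift C i) (to_s1s2 r) = to_s1s2 r.
Proof. exact: (map_mpoly_ext _ (shiftC i)). Qed.

Let F0 (p : {mpoly C[n]}) : p != 0 -> to_s1s2 p != 0.
Proof. by apply: map_mpoly_neq0; move=> a b /eqP; rewrite mpolyC_eq => /eqP. Qed.

Let fs0 (p : {mpoly C[n]}) : p != 0 -> to_s p != 0.
Proof. exact/map_mpoly_neq0/polyC_inj. Qed.

Let phi1 : phi (s1 R) = 'X.
Proof. by rewrite [LHS]subst_sX. Qed.

Let phi2 : phi (s2 R) = - 'X - m%:R.
Proof. by rewrite [LHS]subst_sX. Qed.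

Lemma Sat_sub_annIm P : Sat_Cs (annI_subst f g m) P -> annIm f g m P.
Proof.
move=> [q [q0 [Q Q0 E]]].
apply: (proj2 (opact_twist_invg (to_s f) (fs0 g0) 'X (- 'X) m P)).
exact: (@specialize_annihilator n Ks12 Ks phi (to_s1s2 f) (to_s1s2 g)
  (to_s f) (to_s g) (s1 R) (s2 R) 'X (- 'X - m%:R) phi1 phi2 (phiF f) (phiF g)
  (F0 f0) (F0 g0) (fs0 f0) (fs0 g0) q P Q q0 E Q0).
Qed.

Lemma annIm_sub_Sat P : C_condition m (BernsteinSato f g) ->
  annIm f g m P -> Sat_Cs (annI_subst f g m) P.
Proof.
move=> [b [[PB Bb] bi]] PI.
have P0 := proj1 (opact_twist_invg (to_s f) (fs0 g0) 'X (- 'X) m P) PI.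
have BE : loc_of (to_s1s2 f * to_s1s2 g) (b : Ks12)%:MP
    = opact (@dtwist n Ks12 (to_s1s2 f) (to_s1s2 g) (s1 R) (s2 R)) PB
        (loc_of _ (to_s1s2 f * to_s1s2 g)).
  exact: (etrans (esym (@opact_weyl_const1 n Ks12 (to_s1s2 f * to_s1s2 g)
    (dtwist (s1 R) (s2 R)) b)) Bb).
have liftK : cancel (lift_s1 C) phi := lift_s1K (subst_sC _ _) phi1.
(* This is s2 - (-s1-m) = s1+s2+m. *)
pose l : Ks12 := 'X_ord_max - lift_s1 C (- 'X - m%:R).
have psil : phi l = 0.
  by apply: etrans (rmorphB phi _ _) _; rewrite liftK [X in X - _]phi2 subrr.
have kerE c : phi c = 0 -> exists c', c = l * c'.
  exact: (@kernel_subst C phi (- 'X - m%:R) (subst_sC _ _) phi1 phi2 c).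
(* The shifts start at 1, as do the indices in the C_m-condition. *)
have shfB i : phi (shift C i.+1 b) != 0.
  by rewrite [X in X != _]subst_s_shift; exact: bi.
have [q [Q [q0 Q0 E]]] := @lift_annihilator n Ks12 Ks phi (to_s1s2 f) (to_s1s2 g)
  (to_s f) (to_s g) (s1 R) (s2 R) 'X (- 'X - m%:R) phi1 phi2 (phiF f) (phiF g)
  (F0 f0) (F0 g0) (fs0 f0) (fs0 g0) (shift C) (shfF^~ f) (shfF^~ g)
  (fun i => shiftX C i _) (fun i => shiftX C i _) b PB BE
  (lift_s1 C) l liftK psil kerE shfB P P0.
by exists q; split=> //; exists Q.
Qed.

End Main.

Theorem theorem4p5 (R : realType) (n : nat) (f g : {mpoly R[i][n]}) (m : nat)
  (hf : forall c : R[i], f <> c%:MP) (hg : forall c : R[i], g <> c%:MP)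
  (hB : C_condition m (BernsteinSato f g)) :
  annIm f g m = Sat_Cs (annI_subst f g m).
Proof.
have f0 : f != 0 by apply/eqP => f0; apply: (hf 0); rewrite f0 mpolyC0.
have g0 : g != 0 by apply/eqP => g0; apply: (hg 0); rewrite g0 mpolyC0.
apply/seteqP; split=> P; first exact: annIm_sub_Sat.
exact: Sat_sub_annIm.
Qed.
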